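(* Let $D=(V,E)$ be a finite directed acyclic graph with influence weights $b$ and meeting probabilities $m$, let $S\subseteq V$ be the seed set, and let $\tau\in\mathbb{Z}_+$ be a deadline. Let $ap(v,t)$ be the probability that $v$ is activated exactly at step $t$ in $D$ under the LT-M model with seed set $S$. Then for any $v\in V\setminus S$ and any $t\in\{1,\dots,\tau\}$, $$ap(v,t)=\sum_{u\in N^{in}(v)}b(u,v)\sum_{t'=0}^{t-1}ap(u,t')\cdot m(u,v)\cdot(1-m(u,v))^{t-t'-1},$$ where $N^{in}(v)$ is the set of in-neighbors of $v$ in $D$.
   Context: LT-M model (Linear Threshold with Meeting events) on $D=(V,E)$: $b:E\to[0,1]$ are influence weights with $\sum_{u}b(u,v)\le 1$ for every $v\in V$, and $m:E\to[0,1]$ are meeting probabilities ($b(u,v)=m(u,v)=0$ if $(u,v)\notin E$). Each node $v$ independently draws a threshold $\theta_v$ uniformly at random from $[0,1]$. Time is discrete, $0,1,2,\dots$. At step $0$ exactly the nodes of the seed set $S$ are active; thus $ap(v,0)=1$ for $v\in S$, $ap(v,t)=0$ for $v\in S$, $t>0$, and $ap(v,0)=0$ for $v\notin S$. At each step $t\ge1$, every node $u$ that became active at a step before $t$ stays active and meets each of its currently inactive out-neighbors $v$ with probability $m(u,v)$, independently over pairs and steps. From the step of the first meeting of $u$ and $v$ after $u$'s activation on, $u$ is called an effective in-neighbor of $v$. An inactive node $v$ becomes active at step $t$ if the sum of $b(u,v)$ over its effective in-neighbors $u$ (including those that became effective at step $t$) is at least $\theta_v$; it then starts to meet its out-neighbors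 from step $t+1$. Convention: $0^0=1$. *)

(* Defs.v *)
From HB Require Import structures.
From mathcomp Require Import all_boot all_order all_algebra.
From mathcomp Require Import all_classical all_reals all_analysis.

Set Implicit Arguments.
Unset Strict Implicit.
Unset Printing Implicit Defensive.

Import Order.TTheory GRing.Theory Num.Theory.

Local Open Scope ring_scope.

(* [cycle e c] is about closed walks, so self-loops are excluded as well; this
   is equivalent to the absence of simple directed cycles. *)
Definition acyclic (V : finType) (e : rel V) : Prop :=
  forall c : seq V, cycle e c -> c = [::].

(* Edge functions E -> [0, 1] are extended by 0 to all pairs of nodes. *)
Definition edge_function (R : realType) (V : finType) (e : rel V)
    (f : V -> V -> R) : Prop :=
  (forall u v, 0 <= f u v <= 1) /\ (forall u v, ~~ e u v -> f u v = 0).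

Definition influence_weights (R : realType) (V : finType) (e : rel V)
    (b : V -> V -> R) : Prop :=
  edge_function e b /\ (forall v, \sum_(u : V) b u v <= 1).

Definition meeting_probabilities (R : realType) (V : finType) (e : rel V)
    (m : V -> V -> R) : Prop :=
  edge_function e m.

Section Process.
Variables (R : realType) (V : finType) (e : rel V) (b : V -> V -> R).
Variable S : {set V}.

(* One outcome of the randomness: thresholds, and for every pair (u, v) and
   step t >= 1 whether u meets v at step t, should u be active before t and
   v still be inactive; meet u v 0 is never used. *)
Variables (theta : V -> R) (meet : V -> V -> nat -> bool).

(* The state at the end of step t: the set of active nodes, and the set of
   pairs (u, v) such that u is an effective in-neighbor of v. *)
Fixpoint ltm_state (t : nat) : {set V} * {set V * V} :=
  if t is t'.+1 then
    let: (act, eff) := ltm_state t' in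
    let eff' := eff :|: [set p : V * V | [&& e p.1 p.2, p.1 \in act,
                                             p.2 \notin act & meet p.1 p.2 t]] in
    (act :|: [set v | (v \notin act) &&
                      (theta v <= \sum_(u | (u, v) \in eff') b u v)],
     eff')
  else (S, finset.set0).

Definition active (t : nat) : {set V} := (ltm_state t).1.

Definition activated_at (t : nat) : {set V} :=
  if t is t'.+1 then active t :\: active t' else active 0.

End Process.

Section Probability.
Context d (T : measurableType d) (R : realType) (P : probability T R).

(* Mutual independence of a family of classes of events: the product rule for
   every finite subfamily. *)
Definition mutually_independent (I : eqType) (F : I -> set (set T)) : Prop :=
  forall (s : seq I) (A : I -> set T), uniq s ->
    (forall i, i \in s -> F i (A i)) ->
    P (\bigcap_(i in [set` s]) A i)%classic = (\prod_(i <- s) P (A i))%E.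

Definition generated_events d' (T' : measurableType d') (X : T -> T') :
    set (set T) := preimage_set_system [set: T] X measurable.

Variable V : finType.

Definition ltm_events (theta : V -> {RV P >-> R})
    (meet : V -> V -> nat -> {RV P >-> bool})
    (i : V + V * V * nat) : set (set T) :=
  match i with
  | inl v => generated_events (theta v)
  | inr (u, v, t) => generated_events (meet u v t)
  end.

Definition ltm_randomness (m : V -> V -> R) (theta : V -> {RV P >-> R})
    (meet : V -> V -> nat -> {RV P >-> bool}) : Prop :=
  [/\ forall v (A : set R), measurable A ->
        distribution P (theta v) A = uniform_prob (@ltr01 R) A,
      forall u v t (A : set bool), measurable A ->
        distribution P (meet u v t) A = bernoulli_prob (m u v) A
    & mutually_independent (ltm_events theta meet)].

Definition ap (e : rel V) (b : V -> V -> R) (S : {set V})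
    (theta : V -> {RV P >-> R}) (meet : V -> V -> nat -> {RV P >-> bool})
    (v : V) (t : nat) : R :=
  fine (P [set w | v \in activated_at e b S (fun u => theta u w)
                           (fun u x s => meet u x s w) t]%classic).

End Probability.

(* Main.v *)
(** Fix a node v outside S, and let heard v t be the set of in-neighbors of v
    that have met v by step t after their own activation, whether or not v was
    still inactive at that time. Then v is active at step t >= 1 iff its
    threshold is at most the weight of heard v t. By acyclicity the in-neighbors of v are
    activated independently of v's threshold and of all meetings with v. As the
    threshold is uniform, the probability that v is active at step t is thus the
    expected weight of heard v t, and ap v t is the expected weight of the nodes
    that enter heard v at step t. For one in-neighbor u, the probability N_t
    that u is active but not heard at step t satisfies
    N_(t+1) = ap u (t+1) + N_t * (1 - m u v), and u enters heard v at step t+1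
    with probability N_t * m u v. *)

Require Import Defs.
From mathcomp Require Import all_boot all_order all_algebra.
From mathcomp Require Import all_classical all_reals all_analysis.

Set Implicit Arguments.
Unset Strict Implicit.
Unset Printing Implicit Defensive.

Import Order.TTheory GRing.Theory Num.Theory.

Local Open Scope classical_set_scope.
Local Open Scope ring_scope.

(** * Independence of one class from the sigma-algebra generated by the others *)

(** Mutual independence gives the product rule for finite intersections; for fixed [B] the events
    obeying the rule form a lambda-system, so it extends to the generated sigma-algebra. *)
Lemma mutually_independent_setI (d : measure_display) (T : measurableType d)
    (R : realType) (P : probability T R) (I : choiceType)
    (F : I -> set (set T)) (j : I) (A B : set T) :
  (forall i, F i `<=` measurable) -> (forall i, F i setT) ->
  (forall i, setI_closed (F i)) -> mutually_independent P F ->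
  <<s \bigcup_(i in [set~ j]) F i >> A -> F j B ->
  P (A `&` B) = (P A * P B)%E.
Proof.
move=> mF FT FI indF sA FB.
(* A finite intersection is coded by a family over all indices that is [setT] off [s], so that two
   of them intersect index by index. *)
pose fincap (s : seq I) := [set \bigcap_i C i | C in
  [set C : I -> set T |
    (forall i, F i (C i)) /\ forall i, i \notin s -> C i = setT]].
(* The finite intersections that avoid j form the pi-system to which the
   pi-lambda theorem is applied. *)
pose cyl := [set X | exists2 s : seq I, j \notin s & fincap s X].
have capE s (C : I -> set T) : (forall i, i \notin s -> C i = setT) ->
    \bigcap_i C i = \bigcap_(i in [set` undup s]) C i.
  move=> Cs; apply/seteqP; split=> w Cw i => [_|_]; first exact: Cw.
  have [si|si] := boolP (i \in s); first by apply: Cw; rewrite /= mem_undup.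
  by rewrite Cs.
have cylI : setI_closed cyl.
  move=> X Y [s js [C [CF Cs] <-]] [s' js' [C' [CF' Cs'] <-]].
  exists (s ++ s'); first by rewrite mem_cat negb_or js.
  exists (fun i => C i `&` C' i); last by rewrite bigcapI.
  split=> [i|i]; first exact: FI.
  by rewrite mem_cat negb_or => /andP[/Cs -> /Cs' ->]; rewrite setIT.
have mcyl X : cyl X -> measurable X.
  case=> s _ [C [CF Cs] <-]; rewrite (capE _ _ Cs) bigcap_seq.
  by apply: bigsetI_measurable => i _; exact/mF/CF.
pose H : set (set T) := [set X | measurable X /\ P (X `&` B) = (P X * P B)%E].
suff : <<s cyl >> `<=` H.
  move=> /(_ A)[]//; apply: sub_sigma_algebra2 sA => X [i /= /eqP ij FX].
  exists [:: i]; first by rewrite inE eq_sym.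
  exists (fun k => if k == i then X else setT).
    split=> k; first by case: eqP => [->|].
    by rewrite inE => /negbTE ->.
  apply/seteqP; split=> w; first by move=> /(_ i Logic.I); rewrite eqxx.
  by move=> Xw k _; case: eqP.
have mB := mF _ _ FB.
apply: lambda_system_subset => //.
  apply/dynkin_lambda_system; split.
  - by split=> //; rewrite setTI probability_setT mul1e.
  - move=> X [mX PX]; split; first exact: measurableC.
    have -> : ~` X `&` B = B `\` (X `&` B).
      by rewrite setIC setDIr setDv setU0.
    rewrite measureD ?(le_lt_trans (probability_le1 _ _)) ?ltry//;
      last exact: measurableI.
    have -> : B `&` (X `&` B) = X `&` B by rewrite setICA setIid.
    rewrite [X in (_ - X)%E](_ : _ = P X * P B)%E// probability_setC//.
    by rewrite muleBl ?mul1e ?fin_num_measure ?fin_num_adde_defr.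
  - move=> X tX HX; have mX n : measurable (X n) by case: (HX n).
    split; first exact: bigcupT_measurable.
    rewrite setI_bigcupl !measure_bigcup//; last exact: trivIset_setIr.
      rewrite muleC -(fineK (fin_num_measure P B mB)) -nneseriesZl//.
      apply: eq_eseriesr => n _; rewrite fineK ?fin_num_measure// muleC.
      exact: (HX n).2.
    by move=> n _; exact: measurableI.
move=> X cX; split; first exact: mcyl.
case: cX => s js [C [CF Cs] <-].
have Pcap : P (\bigcap_i C i) = (\prod_(i <- undup s) P (C i))%E.
  by rewrite (capE _ _ Cs) indF ?undup_uniq// => i _; exact: CF.
(* As [j] is not in [s], placing [B] at [j] adds exactly one factor to the product rule. *)
pose C' i := if i == j then B else C i.
have eqC i : i \in undup s -> C' i = C i.
  by rewrite mem_undup /C'; case: eqP => // -> /(negP js).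
have := indF (j :: undup s) C'; rewrite /= mem_undup js undup_uniq => /(_ isT).
rewrite big_cons (eq_big_seq (P \o C)) => [|i si /=]; last by rewrite eqC.
rewrite -Pcap /C' eqxx muleC => <-.
  rewrite (capE _ _ Cs); congr (P _); apply/seteqP; split=> w /=.
    move=> [Cw Bw] i /=; rewrite inE; case: eqP => [//|_] /= si.
    exact: Cw.
  move=> Cw; split=> [i /= si|].
    by move: (Cw i); rewrite /= inE si orbT -/(C' i) eqC//; apply.
  by move: (Cw j); rewrite /= inE eqxx; apply.
by move=> i _; case: eqP => [->|].
Qed.

(** * Deterministic dynamics of one outcome *)

Section Outcome.
Variables (R : realType) (V : finType) (e : rel V) (b : V -> V -> R).
Variables (S : {set V}) (theta : V -> R) (meet : V -> V -> nat -> bool).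

Local Notation active := (active e b S theta meet).

Definition effective (t : nat) : {set V * V} := (ltm_state e b S theta meet t).2.

(* Unlike [effective], this ignores whether v is still inactive, hence does not
   depend on the threshold of v. *)
Fixpoint heard (v : V) (t : nat) : {set V} :=
  if t is t'.+1 then
    heard v t' :|: [set u | [&& e u v, u \in active t' & meet u v t]]%SET
  else finset.set0.

Lemma in_effectiveS u v t : ((u, v) \in effective t.+1) =
  ((u, v) \in effective t) ||
  [&& e u v, u \in active t, v \notin active t & meet u v t.+1].
Proof.
by rewrite /effective /active /=; case: ltm_state => act eff /=; rewrite !inE.
Qed.

Lemma in_activeS v t : (v \in active t.+1) =
  (v \in active t) || (theta v <= \sum_(u | (u, v) \in effective t.+1) b u v).
Proof.
rewrite /effective /active /=; case: ltm_state => act eff /=; rewrite !inE.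
by case: (v \in act).
Qed.

Lemma in_heardS u v t : (u \in heard v t.+1) =
  (u \in heard v t) || [&& e u v, u \in active t & meet u v t.+1].
Proof. by rewrite !inE. Qed.

Arguments heard : simpl never.

Lemma active_le s t : (s <= t)%N -> active s \subset active t.
Proof.
move=> /subnK <-; elim: (t - s)%N => [|n IH]; first by rewrite add0n.
rewrite addSn (fintype.subset_trans IH)//.
by apply/fintype.subsetP => v; rewrite in_activeS => ->.
Qed.

Lemma heard_subset v t : heard v t \subset active t.
Proof.
elim: t => [|t IH]; first exact: finset.sub0set.
apply: fintype.subset_trans (active_le (leqnSn t)).
rewrite finset.subUset IH /=.
by apply/fintype.subsetP => u; rewrite inE => /and3P[].
Qed.

(** As [v] is inactive at step [t.-1], hence at all earlier steps, the inactivity test in the update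
    has always succeeded up to step [t]. *)
Lemma effective_heard u v t : v \notin active t.-1 ->
  ((u, v) \in effective t) = (u \in heard v t).
Proof.
elim: t => [|t IH]; first by rewrite /effective /= !inE.
move=> /= vt; rewrite in_effectiveS in_heardS vt /= IH//.
by apply: contra vt; exact/fintype.subsetP/active_le/leq_pred.
Qed.

(** While [v] is inactive, its effective and heard in-neighbors agree; afterwards [heard] only
    grows, and nonnegative weights keep the sum above the threshold. *)
Lemma in_active_heard v t : (forall u, 0 <= b u v) -> v \notin S ->
  (v \in active t.+1) = (theta v <= \sum_(u in heard v t.+1) b u v).
Proof.
move=> b0 vS; elim: t => [|t IH]; rewrite in_activeS.
  by under eq_bigl do rewrite effective_heard//; rewrite (negbTE vS).
have [vt|vt] := boolP (v \in active t.+1); last first.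
  by under eq_bigl do rewrite effective_heard//.
rewrite IH in vt; apply/esym; apply: le_trans vt _.
rewrite [leRHS](bigID [in heard v t.+1])/=; set W := (X in _ <= X + _).
suff -> : \sum_(u in heard v t.+1) b u v = W by rewrite lerDl sumr_ge0.
apply: eq_bigl => u; apply/idP/andP => [uh|[]//]; split=> //.
by rewrite in_heardS uh.
Qed.

End Outcome.

(** * Measurability of events about random finite sets and the process *)

Section MeasurableBool.
Variables (d : measure_display) (T : measurableType d).
Implicit Types f g : T -> bool.

Lemma measurable_set_or f g : measurable [set w | f w] ->
  measurable [set w | g w] -> measurable [set w | f w || g w].
Proof.
move=> mf mg; rewrite (_ : [set w | _] = [set w | f w] `|` [set w | g w]).
  exact: measurableU.
by apply/seteqP; split=> w /= => /orP.
Qed.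

Lemma measurable_set_and f g : measurable [set w | f w] ->
  measurable [set w | g w] -> measurable [set w | f w && g w].
Proof.
move=> mf mg; rewrite (_ : [set w | _] = [set w | f w] `&` [set w | g w]).
  exact: measurableI.
by apply/seteqP; split=> w /= => /andP.
Qed.

Lemma measurable_set_negb f : measurable [set w | f w] ->
  measurable [set w | ~~ f w].
Proof.
move=> mf; rewrite (_ : [set w | _] = ~` [set w | f w]).
  exact: measurableC.
by apply/seteqP; split=> w /= => /negP.
Qed.

Lemma measurable_set_bool (p : bool) : measurable [set w : T | p].
Proof. by case: p; rewrite ?set_true ?set_false. Qed.

End MeasurableBool.

Lemma measurable_finset_eq (d : measure_display) (T : measurableType d)
    (U : finType) (X : T -> {set U}) (K : {set U}) :
  (forall x, measurable [set w | x \in X w]) -> measurable [set w | X w = K].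
Proof.
move=> mX; rewrite (_ : [set w | _] =
    \bigcap_x (if x \in K then [set w | x \in X w] else ~` [set w | x \in X w])).
  apply: fin_bigcap_measurable; first exact: finite_finset.
  by move=> x _; case: ifP => _; [exact: mX|exact: measurableC].
apply/seteqP; split=> w /= => [<- x _|XK]; first by case: ifPn => // /negP.
apply/setP => x; have := XK x Logic.I; case: ifP => xK /=; first by move->.
by move/negP/negbTE.
Qed.

Lemma measurable_finset_comp (d : measure_display) (T : measurableType d)
    (U : finType) (X : T -> {set U}) (F : {set U} -> set T) :
  (forall x, measurable [set w | x \in X w]) -> (forall K, measurable (F K)) ->
  measurable [set w | F (X w) w].
Proof.
move=> mX mF; rewrite (_ : [set w | _] = \bigcup_K ([set w | X w = K] `&` F K)).
  apply: fin_bigcup_measurable; first exact: finite_finset.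
  by move=> K _; apply: measurableI => //; exact: measurable_finset_eq.
by apply/seteqP; split=> w /= => [FX|[K _ [<-]]//]; exists (X w).
Qed.

(* T is arbitrary so that the two lemmas below also apply to a coarser
   sigma-algebra on the sample space, through [g_sigma_algebraType]. *)
Section Measurability.
Variables (d : measure_display) (T : measurableType d).
Variables (R : realType) (V : finType) (e : rel V) (b : V -> V -> R).
Variables (S : {set V}) (theta : V -> T -> R) (meet : V -> V -> nat -> T -> bool).

Local Notation active_ w :=
  (active e b S (fun u => theta u w) (fun u x s => meet u x s w)).
Local Notation effective_ w :=
  (effective e b S (fun u => theta u w) (fun u x s => meet u x s w)).
Local Notation heard_ w :=
  (heard e b S (fun u => theta u w) (fun u x s => meet u x s w)).

(** [A] is closed under in-neighbors, so the activity of its nodes depends only on their own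
    thresholds and the meetings into them. *)
Lemma measurable_active (A : pred V) (v : V) (t : nat) :
  (forall x y, e x y -> A y -> A x) ->
  (forall y c, A y -> measurable [set w | theta y w <= c]) ->
  (forall x y s, e x y -> A y -> measurable [set w | meet x y s w]) ->
  A v -> measurable [set w | v \in active_ w t].
Proof.
move=> eA mtheta mmeet.
(* Activity and effectiveness depend on each other, so one induction on the step treats both. *)
suff : forall y, A y -> measurable [set w | y \in active_ w t] /\
    forall x, measurable [set w | (x, y) \in effective_ w t].
  by move=> H /H[].
elim: t => [|t IH] y Ay.
  split=> [|x]; first exact: (measurable_set_bool T (y \in S)).
  by rewrite /effective /=; under eq_set do rewrite inE; exact: measurable_set_bool.
have mact z : A z -> measurable [set w | z \in active_ w t] by move=> /IH[].
have meff x : measurable [set w | (x, y) \in effective_ w t.+1].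
  under eq_set do rewrite in_effectiveS.
  apply: measurable_set_or; first exact: (IH y Ay).2.
  have [exy|_] := boolP (e x y); last exact: measurable_set_bool.
  apply: measurable_set_and; first exact: measurable_set_bool.
  apply: measurable_set_and; first exact/mact/(eA _ _ exy).
  apply: measurable_set_and; last exact: mmeet.
  by apply: measurable_set_negb; exact: mact.
split=> //; under eq_set do rewrite in_activeS.
apply: measurable_set_or; first exact: mact.
pose X w := [set x | (x, y) \in effective_ w t.+1]%SET.
rewrite (_ : [set w | _] = [set w | theta y w <= \sum_(x in X w) b x y]).
  apply: (measurable_finset_comp
            (F := fun K => [set w | theta y w <= \sum_(x in K) b x y])) => [x|K].
    by under eq_set do rewrite inE.
  exact: mtheta.
by apply: eq_set => w; under [in RHS]eq_bigl do rewrite inE.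
Qed.

Lemma measurable_heard (v : V) (t : nat) :
  (forall u s, e u v -> (s < t)%N -> measurable [set w | u \in active_ w s]) ->
  (forall u s, e u v -> (s <= t)%N -> measurable [set w | meet u v s w]) ->
  forall u, measurable [set w | u \in heard_ w v t].
Proof.
move=> mact mmeet u; elim: t => [|t IH] in mact mmeet *.
  by under eq_set do rewrite inE; exact: measurable_set_bool.
under eq_set do rewrite in_heardS.
apply: measurable_set_or.
  by apply: IH => x s exv /leqW; [exact: mact|exact: mmeet].
have [euv|_] := boolP (e u v); last exact: measurable_set_bool.
apply: measurable_set_and; first exact: measurable_set_bool.
by apply: measurable_set_and; [exact: mact|exact: mmeet].
Qed.

End Measurability.

(** * Uniform law, acyclicity and finite additivity *)

Lemma uniform_prob01_itvNy (R : realType) (c : R) : 0 <= c <= 1 ->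
  uniform_prob (@ltr01 R) [set x | x <= c] = c%:E.
Proof.
move=> /andP[c0 c1]; rewrite /uniform_prob integral_uniform_pdf.
have -> : [set x | x <= c] `&` `[0, 1] = `[0, c]%classic :> set R.
  apply/seteqP; split=> x /=; rewrite !in_itv /=; first by move=> [-> /andP[->]].
  by move=> /andP[-> xc]; split=> //; exact: le_trans c1.
rewrite (eq_integral (fun=> 1%E)).
  rewrite integral_cst//= lebesgue_measure_itv/= lte_fin mul1e.
  (* The interval formula gives the length only for [0 < c]; the case [c = 0] is separate. *)
  by case: ltgtP c0 => // [_|<-]; rewrite ?oppr0 ?adde0// -EFinB subr0.
move=> x; rewrite inE/= in_itv/= /uniform_pdf => /andP[-> xc].
by rewrite (le_trans xc c1) subr0 invr1.
Qed.

Lemma acyclic_connectN (V : finType) (e : rel V) (u v : V) :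
  acyclic e -> e u v -> ~~ connect e v u.
Proof.
move=> eA euv; apply/negP => /connectP[p pp up].
suff /eA : cycle e (v :: p) by [].
by rewrite /= rcons_path pp -up.
Qed.

Section FineProbability.
Variables (d : measure_display) (T : measurableType d) (R : realType).
Variable P : probability T R.

Lemma fine_probabilityU (A B : set T) : measurable A -> measurable B ->
  A `&` B = set0 -> fine (P (A `|` B)) = fine (P A) + fine (P B).
Proof.
by move=> mA mB AB; rewrite measureU// fineD// fin_num_measure.
Qed.

(** Law of total probability over the finitely many values of [X]. *)
Lemma fine_probability_finset (U : finType) (X : T -> {set U})
    (F : {set U} -> set T) :
  (forall x, measurable [set w | x \in X w]) -> (forall K, measurable (F K)) ->
  fine (P [set w | F (X w) w]) = \sum_K fine (P ([set w | X w = K] `&` F K)).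
Proof.
move=> mX mF.
have mXF K : measurable ([set w | X w = K] `&` F K).
  by apply: measurableI => //; exact: measurable_finset_eq.
rewrite (_ : [set w | _] =
    \bigcup_(K in [set` index_enum {set U}]) ([set w | X w = K] `&` F K)).
  rewrite measure_fin_bigcup//=.
    rewrite -fsbig_seq ?index_enum_uniq// sum_fine// => K _.
    exact: fin_num_measure.
  by move=> K L _ _ [w [[<- _] [<- _]]].
apply/seteqP; split=> w /= => [FX|[K _ [<-]]//]; exists (X w) => //=.
exact: mem_index_enum.
Qed.

End FineProbability.

(** * Which coordinates of the randomness an event depends on *)

Section Ltm.
Variables (R : realType) (V : finType) (e : rel V) (b m : V -> V -> R).
Variable S : {set V}.
Variables (d : measure_display) (T : measurableType d) (P : probability T R).
Variables (theta : V -> {RV P >-> R}) (meet : V -> V -> nat -> {RV P >-> bool}).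
Hypothesis e_acyclic : acyclic e.
Hypothesis b_weights : influence_weights e b.
Hypothesis m_probs : meeting_probabilities e m.
Hypothesis ltm : ltm_randomness m theta meet.

Local Notation active_ w :=
  (active e b S (fun u => theta u w) (fun u x s => meet u x s w)).
Local Notation heard_ w :=
  (heard e b S (fun u => theta u w) (fun u x s => meet u x s w)).
Local Notation ap := (ap e b S theta meet).

Lemma ltm_events_sigma_algebra i : sigma_algebra setT (ltm_events theta meet i).
Proof.
case: i => [v|[[u v] t]]; apply: sigma_algebra_preimage;
  exact: sigma_algebra_measurable.
Qed.

Lemma ltm_events_measurable i : ltm_events theta meet i `<=` measurable.
Proof.
by case: i => [v|[[u v] t]] A [B mB <-]; exact: measurable_funPT.
Qed.

Lemma ltm_events_theta v c : ltm_events theta meet (inl v) [set w | theta v w <= c].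
Proof.
exists `]-oo, c]%classic; first exact: measurable_itv.
by rewrite setTI set_itvE.
Qed.

Lemma ltm_events_meet u v t :
  ltm_events theta meet (inr (u, v, t)) [set w | meet u v t w].
Proof. by exists [set true] => //; rewrite setTI. Qed.

Lemma prob_theta v c : 0 <= c <= 1 -> P [set w | theta v w <= c] = c%:E.
Proof.
move=> c01; have [+ _ _] := ltm => /(_ v [set x | x <= c]).
rewrite uniform_prob01_itvNy// => <-//.
by have := @measurable_itv R `]-oo, c]; rewrite set_itvE.
Qed.

Lemma prob_meet u v t : P [set w | meet u v t w] = (m u v)%:E.
Proof.
have [_ + _] := ltm => /(_ u v t [set true] I) /=.
rewrite bernoulli_probE; last exact: m_probs.1.
by rewrite !diracE mem_set// memNset// mule1 mule0 adde0.
Qed.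

Definition events_but (j : V + V * V * nat) : set (set T) :=
  \bigcup_(i in [set~ j]) ltm_events theta meet i.

Lemma prob_events_but j A B :
  <<s events_but j >> A -> ltm_events theta meet j B ->
  P (A `&` B) = (P A * P B)%E.
Proof.
have [_ _ indF] := ltm; apply: mutually_independent_setI => //.
- exact: ltm_events_measurable.
- by move=> i; have /sigma_algebraP[] := ltm_events_sigma_algebra i.
- by move=> i; have /sigma_algebraP[] := ltm_events_sigma_algebra i.
Qed.

(** The node whose activation the coordinate [j] can influence directly. *)
Definition target (j : V + V * V * nat) : V :=
  match j with inl v => v | inr (_, v, _) => v end.

(** The activity of [u] is determined by thresholds of, and meetings into, [u] and its ancestors;
    acyclicity keeps [target j] out of these nodes. *)
Lemma events_but_active j u t :
  e u (target j) -> <<s events_but j >> [set w | u \in active_ w t].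
Proof.
move=> euj; have jNu := acyclic_connectN e_acyclic euj.
have gen i A : target i != target j -> ltm_events theta meet i A ->
    <<s events_but j >> A.
  move=> ij iA; apply: sub_sigma_algebra; exists i => //= eij.
  by rewrite eij eqxx in ij.
have neq y : connect e y u -> y != target j.
  by apply: contraTneq => ->.
apply: (@measurable_active _ (g_sigma_algebraType (events_but j))
  R V e b S theta meet (fun x => connect e x u)) => //.
- by move=> x y exy; apply: connect_trans; exact: connect1.
- by move=> y c yu; apply: (gen (inl y)); [exact: neq|exact: ltm_events_theta].
- move=> x y s _ yu; apply: (gen (inr (x, y, s))); first exact: neq.
  exact: ltm_events_meet.
Qed.

(** The activity of in-neighbors of [v] is covered by acyclicity. The condition on [j] excludes
    meetings with [v] up to step [t], so [j] may be the threshold of [v] or a later meeting. *)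
Lemma events_but_heard j v t : target j = v ->
  (forall u s, (s <= t)%N -> j != inr (u, v, s)) ->
  forall u, <<s events_but j >> [set w | u \in heard_ w v t].
Proof.
move=> jv jN; apply: (@measurable_heard _ (g_sigma_algebraType (events_but j))
  R V e b S theta meet).
  by move=> u s euv _; apply: events_but_active; rewrite jv.
move=> u s euv st; apply: sub_sigma_algebra; exists (inr (u, v, s)).
  by move=> /= eij; have := jN u s st; rewrite eij eqxx.
exact: ltm_events_meet.
Qed.

Lemma events_but_measurable j A : <<s events_but j >> A -> measurable A.
Proof.
apply; split; first exact: sigma_algebra_measurable.
by move=> X [i _]; exact: ltm_events_measurable.
Qed.

Lemma active_measurable v t : measurable [set w | v \in active_ w t].
Proof.
apply: (@measurable_active _ T R V e b S theta meet xpredT) => // [y c _|x y s _ _].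
  exact/ltm_events_measurable/ltm_events_theta.
exact/ltm_events_measurable/ltm_events_meet.
Qed.

Lemma heard_measurable u v t : measurable [set w | u \in heard_ w v t].
Proof.
apply: measurable_heard => x s _ _; first exact: active_measurable.
exact/ltm_events_measurable/ltm_events_meet.
Qed.

(** * Activation probability as an expected weight *)

Let b0 u v : 0 <= b u v.
Proof. by have [[/(_ u v)/andP[]]] := b_weights. Qed.

Let sum_b01 v (K : {set V}) : 0 <= \sum_(u in K) b u v <= 1.
Proof.
rewrite sumr_ge0//=; apply: le_trans (b_weights.2 v).
by rewrite [leRHS](bigID [in K])/= lerDl sumr_ge0.
Qed.

(* Since the threshold of v is uniform and independent of the set of nodes that
   v has heard, the left-hand side is the expected weight of that set. *)
Lemma prob_active v t : v \notin S ->
  fine (P [set w | v \in active_ w t]) =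
  \sum_u b u v * fine (P [set w | u \in heard_ w v t]).
Proof.
move=> vS; case: t => [|t].
  rewrite [X in P X](_ : _ = set0) ?measure0; last first.
    by apply/seteqP; split=> w //=; rewrite (negbTE vS).
  rewrite big1// => u _; rewrite [X in P X](_ : _ = set0) ?measure0 ?mulr0//.
  by apply/seteqP; split=> w //=; rewrite inE.
have mheard u : measurable [set w | u \in heard_ w v t.+1].
  exact: heard_measurable.
under eq_set do rewrite in_active_heard//.
rewrite (fine_probability_finset P (X := fun w => heard_ w v t.+1)
  (F := fun K : {set V} =>
     [set w | theta v w <= \sum_(u in K) b u v]))//; last first.
  by move=> K; exact/ltm_events_measurable/ltm_events_theta.
(* Independence and uniformity turn the term for [K] into the probability of hearing exactly [K]
   times the weight of [K]. *)
transitivity (\sum_(K : {set V}) \sum_(u in K)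
    b u v * fine (P [set w | heard_ w v t.+1 = K])).
  apply: eq_bigr => K _; rewrite (@prob_events_but (inl v)); last 2 first.
  - apply: (@measurable_finset_eq _ (g_sigma_algebraType (events_but (inl v)))).
    exact: events_but_heard.
  - exact: ltm_events_theta.
  rewrite prob_theta// fineM ?fin_num_measure//=; last exact: measurable_finset_eq.
  by rewrite mulrC mulr_suml.
(* Collecting the sets [K] that contain [u] leaves the probability that [u] is heard. *)
rewrite (exchange_big_dep xpredT)//=; apply: eq_bigr => u _.
rewrite -mulr_sumr; congr (_ * _).
rewrite [RHS](fine_probability_finset P (X := fun w => heard_ w v t.+1)
  (F := fun K : {set V} => [set w | u \in K]))//; last first.
  by move=> K; exact: measurable_set_bool.
rewrite big_mkcond; apply: eq_bigr => K _; case: ifP => uK.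
  by rewrite set_true setIT.
by rewrite set_false setI0 measure0.
Qed.

(** * Recurrences for the pending and heard probabilities *)

Definition pending u v t := [set w | (u \in active_ w t) && (u \notin heard_ w v t)].

Lemma pending_measurable u v t : measurable (pending u v t).
Proof.
apply: measurable_set_and; first exact: active_measurable.
by apply: measurable_set_negb; exact: heard_measurable.
Qed.

(** [pending u v t] involves meetings into [v] only up to step [t], so it is independent of the
    meeting at [t.+1]. *)
Lemma prob_pending_meet u v t : e u v ->
  P (pending u v t `&` [set w | meet u v t.+1 w]) =
  (P (pending u v t) * (m u v)%:E)%E.
Proof.
move=> euv; rewrite -(prob_meet u v t.+1).
apply: (@prob_events_but (inr (u, v, t.+1))); last exact: ltm_events_meet.
apply: (@measurable_set_and _ (g_sigma_algebraType (events_but _))).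
  exact: events_but_active.
apply: (@measurable_set_negb _ (g_sigma_algebraType (events_but _))).
apply: events_but_heard => // x s st; apply/eqP => -[_ ts].
by rewrite -ts ltnn in st.
Qed.

Lemma prob_heardS u v t : e u v ->
  fine (P [set w | u \in heard_ w v t.+1]) =
  fine (P [set w | u \in heard_ w v t]) + fine (P (pending u v t)) * m u v.
Proof.
move=> euv; have mpend := pending_measurable u v t.
have mmeet := ltm_events_measurable (ltm_events_meet u v t.+1).
have -> : fine (P (pending u v t)) * m u v =
    fine (P (pending u v t `&` [set w | meet u v t.+1 w])).
  by rewrite prob_pending_meet// fineM// fin_num_measure.
rewrite -fine_probabilityU; first last.
- by apply/seteqP; split=> // w [/= + [/andP[_ /negP]]].
- exact: measurableI.
- exact: heard_measurable.
congr (fine (P _)); apply/seteqP; split=> w /=; rewrite in_heardS euv /=.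
  have [uh|uh] := boolP (u \in heard_ w v t); first by left.
  by move=> /andP[ua uvt]; right; rewrite /pending /= ua.
by move=> [->//|[/andP[-> _] ->]]; rewrite orbT.
Qed.

(** Either [u] was pending and misses the meeting, or it is activated at [t.+1]; in the latter case
    it cannot have met [v] yet, since meetings start one step later. *)
Lemma prob_pendingS u v t : e u v ->
  fine (P (pending u v t.+1)) =
  ap u t.+1 + fine (P (pending u v t)) * (1 - m u v).
Proof.
move=> euv; have mpend := pending_measurable u v t.
have mmeet := ltm_events_measurable (ltm_events_meet u v t.+1).
have -> : fine (P (pending u v t)) * (1 - m u v) =
    fine (P (pending u v t `\` [set w | meet u v t.+1 w])).
  rewrite measureD ?(le_lt_trans (probability_le1 _ _)) ?ltry//.
  rewrite [X in (_ - X)%E](_ : _ = P (pending u v t) * (m u v)%:E)%E; last first.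
    exact: prob_pending_meet.
  rewrite fineB ?fineM ?fin_numM ?fin_num_measure//.
  by rewrite mulrBr mulr1.
rewrite /Defs.ap -fine_probabilityU; first last.
- apply/seteqP; split=> // w [/=]; rewrite !inE => /andP[uN _] [/andP[ua _] _].
  by rewrite ua in uN.
- exact: measurableD.
- under eq_set do rewrite inE.
  by apply: measurable_set_and; [apply: measurable_set_negb|];
    exact: active_measurable.
congr (fine (P _)); apply/seteqP; split=> w; rewrite /pending /= in_heardS euv !inE /=.
  case: (boolP (u \in active_ w t)) => ua /=.
    rewrite negb_or => /andP[_ /andP[uN uvt]]; right; split=> //; exact/negP.
  by move=> /andP[-> _]; left.
move=> [/andP[uN ->]|[/andP[ua uN] /negP uvt]] /=.
  rewrite (negbTE uN) orbF; apply: contra uN.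
  exact/fintype.subsetP/heard_subset.
rewrite (negbTE uvt) (negbTE uN) ua !andbT.
by rewrite (fintype.subsetP (active_le _ _ _ _ _ (leqnSn t))).
Qed.

(** Unrolled recurrence: a node activated at [t'] has missed [t - t'] meetings since. The term
    [t' = t] has exponent 0 and equals [ap u t] even if [m u v = 1]. *)
Lemma prob_pending u v t : e u v -> fine (P (pending u v t)) =
  \sum_(0 <= t' < t.+1) ap u t' * (1 - m u v) ^+ (t - t').
Proof.
move=> euv; elim: t => [|t IH].
  rewrite big_nat1 mulr1 /pending /Defs.ap; congr (fine (P _)).
  by apply: eq_set => w; rewrite inE andbT.
rewrite prob_pendingS// IH [RHS]big_nat_recr//= subnn expr0 mulr1 [LHS]addrC.
congr (_ + _).
rewrite mulr_suml; apply: eq_big_nat => s /andP[_ st].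
by rewrite subSn// exprSr mulrA.
Qed.

Lemma ap_recurrence v t : v \notin S ->
  ap v t.+1 = \sum_(u | e u v) b u v *
    \sum_(0 <= t' < t.+1) ap u t' * m u v * (1 - m u v) ^+ (t - t').
Proof.
(* Activity is monotone, so [ap] is the increment of the probability of being active. *)
move=> vS; transitivity (fine (P [set w | v \in active_ w t.+1]) -
    fine (P [set w | v \in active_ w t])).
  have mact := active_measurable v; rewrite /Defs.ap.
  rewrite [X in P X](_ : _ = [set w | v \in active_ w t.+1] `\`
      [set w | v \in active_ w t]); last first.
    apply/seteqP; split=> w /=; rewrite inE; first by move=> /andP[/negP].
    by move=> [-> /negP ->].
  rewrite measureD ?(le_lt_trans (probability_le1 _ _)) ?ltry//.
  rewrite setIidr ?fineB ?fin_num_measure// => w /=.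
  by rewrite in_activeS => ->.
rewrite !prob_active// -sumrB (bigID [pred u | e u v])/= [X in _ + X]big1 ?addr0.
  apply: eq_bigr => u euv; rewrite -mulrBr prob_heardS// addrC addKr.
  congr (_ * _); rewrite prob_pending// mulr_suml.
  by apply: eq_bigr => s _; rewrite mulrAC.
by move=> u euv; rewrite (b_weights.1.2 _ _ euv) !mul0r subr0.
Qed.

End Ltm.

Theorem theorem7 (R : realType) (V : finType) (e : rel V) (b m : V -> V -> R)
    (S : {set V}) (tau : nat)
    (d : measure_display) (T : measurableType d) (P : probability T R)
    (theta : V -> {RV P >-> R}) (meet : V -> V -> nat -> {RV P >-> bool})
    (e_acyclic : acyclic e)
    (b_weights : influence_weights e b)
    (m_probs : meeting_probabilities e m)
    (ltm : ltm_randomness m theta meet)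
    (v : V) (vNS : v \notin S)
    (t : nat) (t_ge1 : (1 <= t)%N) (t_le_tau : (t <= tau)%N) :
  ap e b S theta meet v t =
  \sum_(u : V | e u v) b u v *
    \sum_(0 <= t' < t)
      ap e b S theta meet u t' * m u v * (1 - m u v) ^+ (t - t' - 1)%N.
Proof.
case: t t_ge1 {t_le_tau} => // t _.
rewrite (ap_recurrence e_acyclic b_weights m_probs ltm _ vNS).
(* In the range of the sum [s <= t], so [t.+1 - s - 1] is [t - s] without truncation. *)
apply: eq_bigr => u _; congr (_ * _); apply: eq_big_nat => s /andP[_ st].
by rewrite subSn// subn1.
Qed.
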